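(* Let $K$ be a field, $n\ge2$, $\Lambda=K\langle x_1,\dots,x_n\rangle$ the free associative algebra, and let $\lambda,\gamma\in\Lambda$ be comonic polynomials. Then there exists a unique comonic polynomial $\delta\in\Lambda$ such that $\delta$ is a right divisor of both $\lambda$ and $\gamma$, and any other common right divisor of $\lambda$ and $\gamma$ is a right divisor of $\delta$.
   Context: A polynomial in $\Lambda$ is comonic if its constant term is $1$. $\mu\in\Lambda$ is a right divisor of $\alpha\in\Lambda$ if $\alpha\in\Lambda\mu$. *)

(* Defs.v *)
From mathcomp Require Export all_boot all_algebra.
From mathcomp Require Export monalg.

Set Implicit Arguments.
Unset Strict Implicit.
Unset Printing Implicit Defensive.

Import GRing.Theory.
Local Open Scope ring_scope.

(* The monoid algebra over K of the free monoid {fmonom 'I_n} of words in n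
   letters, i.e. noncommutative polynomials; the variable x_i is << fmu i >>. *)
Notation freeAlg K n := {malg K[{fmonom 'I_n}]}.

(* [mone] is the empty word. *)
Definition comonic (K : fieldType) (n : nat) (f : freeAlg K n) : Prop :=
  f@_mone = 1.

Definition right_divisor (R : nzRingType) (mu alpha : R) : Prop :=
  exists nu : R, alpha = nu * mu.

(* Main.v *)
(* The free algebra has a weak algorithm (Cohn): if c a = d b <> 0 and
   deg b <= deg a, then subtracting a left multiple of b lowers the degree of a.
   To see this, strip a longest word w of c from the left in both products: up
   to terms of degree < deg a this leaves c_w a on one side and a left multiple
   of b on the other. Euclid's algorithm then shows that two left principal
   ideals with nonzero intersection intersect in a principal left ideal. Two
   common right divisors of lambda <> 0 and gamma generate ideals that both
   contain lambda, so their least common left multiple exists and is again a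
   common right divisor; hence one of maximal degree is the greatest. *)

Require Import Defs.
From mathcomp Require Import finmap zify.
From Stdlib Require Import Classical.

Set Implicit Arguments.
Unset Strict Implicit.
Unset Printing Implicit Defensive.

Import GRing.Theory.
Local Open Scope ring_scope.

(* Cohn's weak algorithm for pairs; [sz] is the degree plus one, with [sz 0 = 0]. *)
Record weak_algorithm (R : nzRingType) (sz : R -> nat) : Prop := {
  wa_size_eq0 : forall a : R, (sz a == 0)%N = (a == 0);
  wa_sizeM : forall a b : R,
    a != 0 -> b != 0 -> (sz a + sz b <= (sz (a * b)%R).+1)%N;
  wa_size1 : forall a : R, sz a = 1%N -> exists b, b * a = 1;
  wa_reduce : forall a b c d : R,
    c != 0 -> a != 0 -> c * a = d * b -> (sz b <= sz a)%N ->
    exists q, (sz (a - q * b)%R < sz a)%N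
}.

(** * Divisibility in a ring with a weak algorithm *)

Section WeakAlgorithm.
Context (R : nzRingType) (sz : R -> nat) (wa : weak_algorithm sz).
Implicit Types a b c d m x : R.

Lemma right_divisor_trans a b c :
  right_divisor a b -> right_divisor b c -> right_divisor a c.
Proof. by case=> p -> [q ->]; exists (q * p); rewrite mulrA. Qed.

Lemma right_divisor_neq0 a b : right_divisor a b -> b != 0 -> a != 0.
Proof. by case=> c ->; apply: contra_neq => ->; rewrite mulr0. Qed.

Lemma wa_size_gt0 a : a != 0 -> (0 < sz a)%N.
Proof. by rewrite lt0n (wa_size_eq0 wa). Qed.

Lemma wa_mulf_neq0 a b : a != 0 -> b != 0 -> a * b != 0.
Proof.
move=> a0 b0; rewrite -(wa_size_eq0 wa).
by have := wa_sizeM wa a0 b0; have := wa_size_gt0 a0; have := wa_size_gt0 b0; lia.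
Qed.

Lemma wa_mulIf a b c : c != 0 -> a * c = b * c -> a = b.
Proof.
move=> c0 /eqP; rewrite -subr_eq0 -mulrBl => abc0.
apply/eqP; rewrite -subr_eq0; apply: contraLR abc0 => ab0.
exact: wa_mulf_neq0.
Qed.

Lemma wa_size_right_divisor a b :
  right_divisor a b -> b != 0 -> (sz a <= sz b)%N.
Proof.
case=> c -> ca0; have a0 : a != 0 by apply: contra_neq ca0 => ->; rewrite mulr0.
have c0 : c != 0 by apply: contra_neq ca0 => ->; rewrite mul0r.
by have := wa_sizeM wa c0 a0; have := wa_size_gt0 c0; lia.
Qed.

(** In [b = s * a] the size bound for products leaves only size 1 for [s], so [s] has a left
    inverse. *)
Lemma wa_right_divisor_sym a b :
  right_divisor a b -> b != 0 -> (sz b <= sz a)%N -> right_divisor b a.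
Proof.
case=> s -> sa0 le_ba.
have a0 : a != 0 by apply: contra_neq sa0 => ->; rewrite mulr0.
have s0 : s != 0 by apply: contra_neq sa0 => ->; rewrite mul0r.
have [|t ts1] := wa_size1 wa (a := s).
  by have := wa_sizeM wa s0 a0; have := wa_size_gt0 s0; lia.
by exists t; rewrite mulrA ts1 mul1r.
Qed.

(** Equivalently, [m] generates the left ideal $Ra \cap Rb$. *)
Definition is_llcm a b m : Prop :=
  [/\ right_divisor a m, right_divisor b m
    & forall x, right_divisor a x -> right_divisor b x -> right_divisor m x].

Lemma llcm_exists a b c d :
  c != 0 -> a != 0 -> b != 0 -> c * a = d * b -> exists m, is_llcm a b m.
Proof.
have [N] := ubnP (sz a + sz b); elim: N => [|N IH] in a b c d *.
  by move=> + _ _ _ _; rewrite ltn0.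
wlog le_ba : a b c d / (sz b <= sz a)%N => [wlg|].
  have [le_ba|lt_ab] := leqP (sz b) (sz a); first exact: wlg le_ba.
  rewrite addnC => lt_N c0 a0 b0 e.
  have d0 : d != 0.
    by move: (wa_mulf_neq0 c0 a0); rewrite e; apply: contra_neq => ->; rewrite mul0r.
  have [m [bm am mP]] := wlg _ _ d c (ltnW lt_ab) lt_N d0 b0 a0 (esym e).
  by exists m; split; [exact: am | exact: bm | move=> x ax bx; exact: mP].
move=> lt_N c0 a0 b0 e; have [q lt_a1] := wa_reduce wa c0 a0 e le_ba.
have [a1_0|a1_0] := eqVneq (a - q * b) 0.
  have aE : a = q * b by apply/eqP; rewrite -subr_eq0 a1_0.
  exists a; split; [by exists 1; rewrite mul1r | by exists q |].
  by move=> x ax _; exact: ax.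
(* The reduced pair again has a nonzero common left multiple, with the same cofactor [c], so the
   induction applies. *)
have e1 : c * (a - q * b) = (d - c * q) * b.
  by rewrite mulrBr mulrBl e mulrA.
have [|m [[s ms] [t mt] mP]] := IH _ _ _ _ _ c0 a1_0 b0 e1; first by lia.
(* The multiple found for the reduced pair is [s * (a - q * b) = t * b]; adding [s * q * b] turns it
   into a common multiple of [a] and [b]. Conversely [p * a = r * b] makes [p * (a - q * b)] a
   multiple of [b], and cancelling [a - q * b] shows that [p] is a left multiple of [s]. *)
exists (s * a); split; first by exists s.
  by exists (t + s * q); rewrite mulrDl -mt ms -[s * q * b]mulrA -mulrDr subrK.
move=> _ [p ->] [r pa_rb].
have [||k kP] := mP (p * (a - q * b)); first by exists p.
  by exists (r - p * q); rewrite mulrBr mulrBl -mulrA pa_rb.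
exists k; rewrite mulrA; congr (_ * _); apply: (wa_mulIf a1_0).
by rewrite kP ms mulrA.
Qed.

Definition is_gcrd a b d : Prop :=
  [/\ right_divisor d a, right_divisor d b
    & forall x, right_divisor x a -> right_divisor x b -> right_divisor x d].

Lemma gcrd_exists a b : a != 0 -> b != 0 -> exists d, is_gcrd a b d.
Proof.
move=> a0 b0.
(* Starting from the divisor 1, each common divisor that is not greatest is replaced by a strictly
   larger one; [sz a] bounds the climb. *)
suff climb N d : (sz a - sz d < N)%N ->
    right_divisor d a -> right_divisor d b -> exists d', is_gcrd a b d'.
  by apply: (climb _ 1 (ltnSn _)); [exists a | exists b]; rewrite mulr1.
elim: N => // N IH in d *; move=> lt_N da db.
have [dP|] := classic (forall x,
  right_divisor x a -> right_divisor x b -> right_divisor x d).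
  by exists d; split.
move/not_all_ex_not => [x xP].
have [xa xP1] := imply_to_and _ _ xP; have [xb xd] := imply_to_and _ _ xP1.
have [m [dm xm mP]] : exists m, is_llcm d x m.
  have [[p ap] [q aq]] := (da, xa).
  apply: (@llcm_exists d x p q); last by rewrite -ap.
  - by apply: contra_neq a0 => p0; rewrite ap p0 mul0r.
  - exact: right_divisor_neq0 da a0.
  - exact: right_divisor_neq0 xa a0.
have [ma mb] := (mP _ da xa, mP _ db xb).
have m0 := right_divisor_neq0 ma a0.
apply: (IH m) => //.
have le_ma := wa_size_right_divisor ma a0.
(* If [m] were no larger than [d], then [m] would right-divide [d], and so would [x], against its
   choice. *)
have [le_md|] := leqP (sz m) (sz d); last by lia.
case: xd; apply: right_divisor_trans xm _; exact: wa_right_divisor_sym le_md.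
Qed.

End WeakAlgorithm.

Lemma eqseq_catl (T : eqType) (s t r : seq T) :
  (s ++ t == r) = (take (size s) r == s) && (t == drop (size s) r).
Proof.
apply/eqP/andP => [<-|[/eqP {2}<- /eqP ->]]; last exact: cat_take_drop.
by rewrite take_size_cat // drop_size_cat // !eqxx.
Qed.

Notation fsize := (mmeasure (@fdeg _)).

(** * Stripping prefixes of words in the free algebra *)

Section FreeAlgebra.
Context (K : fieldType) (I : choiceType).
Local Notation A := {malg K[{fmonom I}]}.
Local Notation word := {fmonom I}.
Implicit Types (a b c d f g : A) (u v w : word).

Lemma free_alg_ind (P : A -> Prop) :
  P 0 -> (forall f g, P f -> P g -> P (f + g)) ->
  (forall k u, P << k *g u >>) -> forall f, P f.
Proof. by move=> P0 PD PU f; rewrite [f]monalgE; apply: big_ind. Qed.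

Lemma mcoeffUM k u f v :
  (<< k *g u >> * f)@_v =
    if take (size u) v == u :> seq I then k * f@_(FMonom (drop (size u) v))
    else 0.
Proof.
elim/free_alg_ind: f => [|f g IHf IHg|l w].
- by rewrite mulr0 !mcoeff0 mulr0 if_same.
- rewrite mulrDr !mcoeffD (congr2 +%R IHf IHg).
  by case: ifP => _; rewrite ?mulrDr ?addr0.
rewrite malgM_def fgmulUU !mcoeffU -!val_eqE /= fmM eqseq_catl.
by case: eqP => //= _; rewrite mulrnAr.
Qed.

(* Cohn's left transduction by [w]. *)
Definition lquot w f : A :=
  [malg v in [fset FMonom (drop (size w) u) | u : word in msupp f]%fset
     => f@_(mmul w v)].

Lemma lquotE w f v : (lquot w f)@_v = f@_(mmul w v).
Proof.
rewrite mcoeffE; case: ifPn => // vE; apply/esym/mcoeff_outdom.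
(* The domain of [lquot] may contain words too many; it only has to contain every [v] for which
   [mmul w v] lies in the support. *)
apply: contra vE => wv_f; apply/imfsetP; exists (mmul w v) => //=.
by apply/val_inj; rewrite /= fmM drop_size_cat.
Qed.

Lemma lquotD w f g : lquot w (f + g) = lquot w f + lquot w g.
Proof. by apply/malgP => v; rewrite !(lquotE, mcoeffD). Qed.

Lemma lquot1 f : lquot mone f = f.
Proof. by apply/malgP => v; rewrite lquotE mul1m. Qed.

Lemma lquotM u v f : lquot (mmul u v) f = lquot v (lquot u f).
Proof. by apply/malgP => w; rewrite !lquotE mulmA. Qed.

(* [f@_mone] is the augmentation: [lquot (fmu x)] is a twisted derivation. *)
Lemma lquot_letterM (x : I) f g :
  lquot (fmu x) (f * g) = lquot (fmu x) f * g + f@_mone *: lquot (fmu x) g.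
Proof.
elim/free_alg_ind: f => [|f1 f2 IH1 IH2|k u].
- have -> : lquot (fmu x) 0 = 0 by apply/malgP => v; rewrite lquotE !mcoeff0.
  apply/malgP => v; rewrite !mul0r mcoeff0 scale0r addr0.
  by rewrite lquotE !mcoeff0.
- by rewrite mulrDl !lquotD (congr2 +%R IH1 IH2) mulrDl mcoeffD scalerDl addrACA.
apply/malgP => v; rewrite mcoeffD mcoeffZ !lquotE mcoeffUM fmM fmU /= mcoeffU.
(* For the empty word only the augmentation term survives, for a nonempty word only the other
   one. *)
case: u => [[|y u]].
  have -> : lquot (fmu x) << k *g FMonom [::] >> = 0.
    apply/malgP => w; rewrite lquotE mcoeffU mcoeff0 -val_eqE /= fmM fmU /=.
    by [].
  rewrite mul0r mcoeff0 add0r -val_eqE /= fm1 eqxx mulr1n.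
  by congr (_ * _@_ _); apply/val_inj; rewrite /= fmM fmU.
have -> : lquot (fmu x) << k *g FMonom (y :: u) >> =
    << k *+ (x == y) *g FMonom u >>.
  apply/malgP => w; rewrite lquotE !mcoeffU -!val_eqE /= fmM fmU /=.
  by rewrite eqseq_cons eq_sym -mulnb mulrnA.
rewrite mcoeffUM -[_ == mone]val_eqE /= fm1 mulr0n mul0r addr0 eqseq_cons.
by case: eqP => _ //=; rewrite ?mulr0n ?mul0r ?if_same.
Qed.

(** * Degree estimates and the weak algorithm *)

Lemma fsize_leP f m :
  reflect (forall u, (m <= fdeg u)%N -> f@_u = 0) (fsize f <= m)%N.
Proof.
apply: (iffP idP) => [le_fm u le_mu|f0].
  exact/mcoeff_outdom/mmeasure_mnm_ge/(leq_trans le_fm).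
rewrite mmeasureE; apply/bigmax_leqP_seq => u uf _; rewrite ltnNge.
by apply/negP => /f0/eqP; rewrite mcoeff_eq0 uf.
Qed.

Lemma fsize_top f : f != 0 -> exists2 u, f@_u != 0 & fsize f = (fdeg u).+1.
Proof.
move=> f0; have [m sf] : exists m, fsize f = m.+1.
  by exists (fsize f).-1; exact: malgSpred.
apply: NNPP => top; suff: (fsize f <= m)%N by rewrite sf ltnn.
apply/fsize_leP => u le_mu; apply/eqP/negPn/negP => fu; apply: top; exists u => //.
move: fu; rewrite mcoeff_neq0 => /(mmeasure_mnm_lt (@fdeg _)).
by rewrite sf => lt_um; apply/eqP; rewrite eqSS eqn_leq le_mu.
Qed.

Lemma fsizeB f g : (fsize (f - g) <= maxn (fsize f) (fsize g))%N.
Proof. by rewrite -(mmeasureN _ g); exact: mmeasureD_le. Qed.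

Lemma fsizeZ k f : (fsize (k *: f) <= fsize f)%N.
Proof.
apply/fsize_leP => u le_fu; rewrite mcoeffZ.
by rewrite (fsize_leP f _ (leqnn _)) ?mulr0.
Qed.

Lemma fsize_lquot w f : (fsize (lquot w f) <= fsize f - fdeg w)%N.
Proof.
apply/fsize_leP => u le_u; rewrite lquotE.
by apply: (fsize_leP f _ (leqnn _)); rewrite fdegM; lia.
Qed.

Lemma fsize_le1 f : (fsize f <= 1)%N -> f = (f@_mone)%:MP.
Proof.
move=> /fsize_leP f1; apply/malgP => u; rewrite mcoeffC.
case: eqVneq => [->|] //=; rewrite -(fdeg_eq0 u) => u0.
by rewrite f1 // lt0n.
Qed.

Definition lquot_defect w f g : A := lquot w (f * g) - lquot w f * g.

(** Induction on [w], adding letters at its end: by the twisted Leibniz rule a new letter strips the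
    old defect and adds a scalar multiple of [lquot (fmu x) g], whose degree is below that of
    [g]. *)
Lemma fsize_lquot_defect w f g :
  (fsize (lquot_defect w f g) <= (fsize g).-1)%N.
Proof.
case: w => s; elim/last_ind: s => [|s x IH].
  have -> : FMonom [::] = mone :> word by apply/val_inj; rewrite /= fm1.
  by rewrite /lquot_defect !lquot1 subrr mmeasure0.
have -> : FMonom (rcons s x) = mmul (FMonom s) (fmu x).
  by apply/val_inj; rewrite /= fmM fmU cats1.
set w := FMonom s in IH *.
have -> : lquot_defect (mmul w (fmu x)) f g =
    (lquot w f)@_mone *: lquot (fmu x) g + lquot (fmu x) (lquot_defect w f g).
  rewrite {1}/lquot_defect !lquotM -{1}[lquot w (f * g)](subrK (lquot w f * g)).
  rewrite lquotD lquot_letterM -/(lquot_defect w f g) [_ * g + _]addrC.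
  by rewrite addrA addrK addrC.
apply: leq_trans (mmeasureD_le _ _ _) _; rewrite geq_max; apply/andP; split.
  apply: leq_trans (fsizeZ _ _) (leq_trans (fsize_lquot _ _) _).
  by rewrite fdegU subn1.
by apply: leq_trans (fsize_lquot _ _) _; rewrite fdegU; lia.
Qed.

Lemma lquot_top w c : fsize c = (fdeg w).+1 -> lquot w c = (c@_w)%:MP.
Proof.
move=> sc; rewrite [lquot w c]fsize_le1 ?lquotE ?mulm1 //.
by apply: leq_trans (fsize_lquot _ _) _; rewrite sc; lia.
Qed.

(** For top words [w] of [c] and [v] of [a], the defect is too short to reach [v], so the
    coefficient of [c * a] at [mmul w v] is the product of the two top coefficients. *)
Lemma fsizeM_ge c a :
  c != 0 -> a != 0 -> (fsize c + fsize a <= (fsize (c * a)).+1)%N.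
Proof.
move=> /fsize_top[w cw sc] /fsize_top[v av sa].
have rv : (lquot_defect w c a)@_v = 0.
  by apply: (fsize_leP _ _ (fsize_lquot_defect w c a)); rewrite sa.
have : (c * a)@_(mmul w v) != 0.
  rewrite -lquotE -[lquot w _](subrK (lquot w c * a)) mcoeffD rv add0r.
  by rewrite lquot_top // mcoeffCM mulf_neq0.
rewrite mcoeff_neq0 => /(mmeasure_mnm_lt (@fdeg _)) lt_wv.
by rewrite sc sa addSn addnS !ltnS -fdegM.
Qed.

Lemma fsize_gt0 f : f != 0 -> (0 < fsize f)%N.
Proof. by move=> f0; rewrite lt0n mmeasure_eq0. Qed.

Lemma free_reduce a b c d :
  c != 0 -> a != 0 -> c * a = d * b -> (fsize b <= fsize a)%N ->
  exists q, (fsize (a - q * b) < fsize a)%N.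
Proof.
move=> /fsize_top[w cw sc] a0 e le_ba.
(* Stripping [w] from [c * a = d * b] gives [c@_w *: a] plus a defect on the left and
   [lquot w d * b] plus a defect on the right. Solving for [a] yields this quotient, and the
   remainder is a scaled difference of defects. *)
exists ((c@_w)^-1 *: lquot w d).
have -> : a - (c@_w)^-1 *: lquot w d * b =
    (c@_w)^-1 *: (lquot_defect w d b - lquot_defect w c a).
  rewrite /lquot_defect e (lquot_top sc) mul_malgC opprB [in RHS]addrC subrKA.
  by rewrite [RHS]scalerDr scalerN scalerA (mulVf cw) scale1r -scalerAl.
rewrite -(ltn_predK (fsize_gt0 a0)) ltnS.
apply: leq_trans (fsizeZ _ _) (leq_trans (fsizeB _ _) _).
rewrite geq_max; apply/andP; split; last exact: fsize_lquot_defect.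
apply: leq_trans (fsize_lquot_defect w d b) _.
by rewrite -!subn1; exact: leq_sub2r.
Qed.

Lemma free_weak_algorithm : weak_algorithm (fun f : A => fsize f).
Proof.
split; [exact: mmeasure_eq0 | exact: fsizeM_ge | | exact: free_reduce].
move=> a sa; exists ((a@_mone)^-1)%:MP.
have aC : a = (a@_mone)%:MP by apply: fsize_le1; rewrite sa.
have a1 : a@_mone != 0.
  by rewrite -(malgC_eq (K := word)) -aC malgC0E -(mmeasure_eq0 (@fdeg _)) sa.
rewrite -mpolyC1E -(mulVf a1) mpolyCM; congr (_ * _); exact: aC.
Qed.

(** * Constant terms and normalisation *)

Lemma mcoeff1M f g : (f * g)@_mone = f@_mone * g@_mone.
Proof. exact: rmorphM (mcoeff mone) f g. Qed.

Lemma comonic_neq0 f : f@_mone = 1 -> f != 0.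
Proof.
by move=> f1; apply/eqP => f0; move: f1; rewrite f0 mcoeff0 => /eqP;
  rewrite eq_sym oner_eq0.
Qed.

(** Mutual divisibility forces equal degrees, so the cofactor is a constant, and comparing constant
    terms makes it 1. *)
Lemma right_divisor_comonic_eq f g :
  f@_mone = 1 -> g@_mone = 1 -> right_divisor f g -> right_divisor g f -> f = g.
Proof.
move=> f1 g1 fg gf; have [f0 g0] := (comonic_neq0 f1, comonic_neq0 g1).
have le_gf := wa_size_right_divisor free_weak_algorithm gf f0.
have [s gE] := fg.
have s0 : s != 0 by apply: contra_neq g0 => s0; rewrite gE s0 mul0r.
have sC : s = (s@_mone)%:MP.
  apply: fsize_le1; rewrite -(leq_add2r (fsize f)) add1n.
  by apply: leq_trans (fsizeM_ge s0 f0) _; rewrite -gE ltnS.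
have s1 : s@_mone = 1 by rewrite -g1 gE mcoeff1M f1 mulr1.
by rewrite gE sC s1 mpolyC1E mul1r.
Qed.

End FreeAlgebra.

Theorem theorem4p16 (K : fieldType) (n : nat) (hn : (2 <= n)%N)
    (lambda gamma : freeAlg K n)
    (hlambda : comonic lambda) (hgamma : comonic gamma) :
  exists! delta : freeAlg K n,
    comonic delta /\
    right_divisor delta lambda /\
    right_divisor delta gamma /\
    (forall mu : freeAlg K n,
       right_divisor mu lambda -> right_divisor mu gamma ->
       right_divisor mu delta).
Proof.
have wa := free_weak_algorithm K 'I_n.
have [l0 g0] := (comonic_neq0 hlambda, comonic_neq0 hgamma).
have [d [[p lp] [q gq] dP]] := gcrd_exists wa l0 g0.
(* The constant term of [d] divides that of [lambda], which is 1; hence [d] can be rescaled to a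
   comonic polynomial. *)
have d1 : d@_mone != 0.
  apply: contra_eq_neq hlambda => d1.
  by rewrite lp mcoeff1M d1 mulr0 eq_sym oner_eq0.
have dE : d = (d@_mone)%:MP * ((d@_mone)^-1 *: d).
  by rewrite mul_malgC scalerA mulfV // scale1r.
exists ((d@_mone)^-1 *: d); split.
  split; first by rewrite /comonic mcoeffZ mulVf.
  split; first by exists (p * (d@_mone)%:MP); rewrite -mulrA -dE.
  split; first by exists (q * (d@_mone)%:MP); rewrite -mulrA -dE.
  move=> mu /dP h /h{h} [r {2}->].
  by exists ((d@_mone)^-1 *: r); exact: scalerAl.
move=> e [e1 [el [eg eP]]].
apply: right_divisor_comonic_eq e1 _ _; first by rewrite mcoeffZ mulVf.
  by apply: eP; [exists (p * (d@_mone)%:MP) | exists (q * (d@_mone)%:MP)];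
    rewrite -mulrA -dE.
have [r re] : right_divisor e d := dP e el eg.
by exists ((d@_mone)^-1 *: r); rewrite {2}re; exact: scalerAl.
Qed.
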